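(* Let $M,m,n$ be integers with $0\le m<M\le n$ and $M+m\le n+1$. Then the collection $\mathcal{A}_{\max}$ (for the parameters $M,m,n$) has $e_{\max}$ edges, and no collection of arcs satisfying conditions $M,m,n$ can have more than $e_{\max}$ edges, where $$e_{\max}=\begin{cases}\tfrac12\left(M+2Mn+2Mm-M^2-m^2-m-2n\right) & \text{if } 2M\le n+1,\\[2pt] \tfrac12\left(M+2Mn-2Mm-M^2-m^2+2mn+m-2n\right) & \text{if } 2M\ge n+1.\end{cases}$$ Moreover (when $M+m\le n+1$), the minimum edge count needed to guarantee an agreement of $M$ with fixed $m$ and $n$ is $$e_{\min}=\begin{cases}\tfrac32 M+Mn+Mm-\tfrac12M^2-\tfrac32 m-\tfrac12 m^2-2n & \text{if } 2M\le n+3,\\[2pt] \tfrac32 M+Mn-Mm-\tfrac12 M^2+\tfrac32 m+mn-\tfrac12m^2-2n & \text{if } 2M>n+3.\end{cases}$$ That is, $e_{\min}$ is the minimum number such that every collection of $n$ arcs with minimum agreement number $m$ and at least $e_{\min}$ edges has maximum agreement number at least $M$.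
   Context: A circular arc is a connected arc $[x,y]$ on a fixed circle, traversed clockwise from its left endpoint $x$ to its right endpoint $y$. All $2n$ endpoints of a collection of $n$ arcs are assumed pairwise distinct. For a point $p$ on the circle, the agreement number $a(p)$ is the number of arcs of the collection containing $p$; the maximum and minimum agreement numbers of the collection are $\max_p a(p)$ and $\min_p a(p)$. A collection satisfies conditions $M,m,n$ if it consists of $n$ arcs and has maximum agreement number $M$ and minimum agreement number $m$. The number of edges of a collection is the number of edges of its intersection graph, i.e. the number of unordered pairs of its arcs that intersect. Guaranteeing an agreement of $M$ means guaranteeing that the maximum agreement number is at least $M$. Definition of $\mathcal{A}_{\max}$: place $2n$ distinct points on the circle and label them, in clockwise order from a starting point, by the sequence consisting of $M-m$ symbols $L$, then the pair $R,L$ repeated $n-M+m$ times, then $M-m$ symbols $R$. Let $L_1,\dots,L_n$ be the points labelled $L$ and $R_1,\dots,R_n$ those labelled $R$, each numbered in clockwise order from the starting point. $\mathcal{A}_{\max}$ consists of the $n$ arcs $A_1,\dots,A_m,B_{m+1},\dots,B_n$, where $A_i$ ($1\le i\le m$) has left endpoint $L_{n-m+i}$ and right endpoint $R_i$ (so it runs clockwise from $L_{n-m+i}$, past the end of the sequence and through the starting point, to $R_i$), and $B_{m+i}$ ($1\le i\le n-m$) has left endpoint $L_i$ and right endpoint $R_{m+i}$.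
   Formalization: Minimality of e_min is claimed only for M > m+1: if M = m+1, every collection with minimum agreement m already has maximum agreement at least M, so every number guarantees M (e.g. n=2, m=1, M=2: 0 suffices, the formula gives 1). That e_min edges suffice is kept for all M. *)

(* Defs.v *)
From mathcomp Require Import all_boot all_order all_algebra.
From mathcomp Require Import boolp reals ring.

Set Implicit Arguments.
Unset Strict Implicit.
Unset Printing Implicit Defensive.
Import Order.TTheory GRing.Theory Num.Theory.
Local Open Scope ring_scope.

(* The circle is R/Z, of circumference 1: a point is given by its clockwise
   distance, in [0, 1[, from a fixed base point. *)
Definition circle (R : realType) := {x : R | 0 <= x < 1}.

(* Length in [0, 1[ of the clockwise path from x to y. *)
Definition cw (R : realType) (x y : circle R) : R :=
  if val x <= val y then val y - val x else 1 + val y - val x.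

Record circular_arc (R : realType) :=
  Arc { left_end : circle R; right_end : circle R }.

(* p lies on the closed arc [left_end A, right_end A]: going clockwise from the
   left endpoint, p is met no later than the right endpoint. *)
Definition on_arc (R : realType) (A : circular_arc R) (p : circle R) : bool :=
  cw (left_end A) p <= cw (left_end A) (right_end A).

Definition arcs_meet (R : realType) (A B : circular_arc R) : Prop :=
  exists p : circle R, on_arc A p /\ on_arc B p.

Section Collections.
Variables (R : realType) (n : nat).
Implicit Types (C : 'I_n -> circular_arc R) (p : circle R).

Definition endpoint C (e : 'I_n * bool) : circle R :=
  if e.2 then left_end (C e.1) else right_end (C e.1).

(* The 2n endpoints are pairwise distinct; in particular no arc is reduced to a
   point, and the family has no repetition. *)
Definition distinct_endpoints C : Prop := injective (endpoint C).

Definition agreement C p : nat := #|[set i : 'I_n | on_arc (C i) p]|.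

Definition agreement_value C (k : nat) : bool :=
  `[< exists p, agreement C p = k >].

Lemma agreement_value_ex C : exists k, agreement_value C k.
Proof.
have h0 : 0 <= (0 : R) < 1 by rewrite lexx ltr01.
by exists (agreement C (exist _ 0 h0)); apply/asboolP; exists (exist _ 0 h0).
Qed.

Lemma agreement_value_le C (k : nat) : agreement_value C k -> (k <= n)%N.
Proof. by move/asboolP => [p <-]; rewrite -[leqRHS]card_ord max_card. Qed.

Definition max_agreement C : nat :=
  ex_maxn (agreement_value_ex C) (@agreement_value_le C).

Definition min_agreement C : nat := ex_minn (agreement_value_ex C).

Definition satisfies_conditions C (M m : nat) : Prop :=
  [/\ distinct_endpoints C, max_agreement C = M & min_agreement C = m].

(* Edges of the intersection graph; an unordered pair {i, j} is encoded by
   (i, j) with i < j. *)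
Definition num_edges C : nat :=
  #|[set e : 'I_n * 'I_n |
      (e.1 < e.2)%N && `[< arcs_meet (C e.1) (C e.2) >]]|.

End Collections.

(* pts lists pairwise distinct points in clockwise order, within one turn
   starting from s (where s itself may be the first of them). *)
Definition clockwise_from (R : realType) (s : circle R) (pts : seq (circle R)) :=
  sorted (fun x y => cw s x < cw s y) pts.

(* The sequence of labels, with L coded by true and R by false. *)
Definition Amax_labels (n M m : nat) : bitseq :=
  nseq (M - m) true ++ flatten (nseq (n - M + m) [:: false; true])
    ++ nseq (M - m) false.

(* nth s (mask w pts) k is the point L_(k+1), and nth s (mask (map negb w) pts) k
   is R_(k+1).  With j = i - 1 in the 0-based numbering of the arcs, the arc
   A_i = [L_(n-m+i), R_i] is the one of index j < m, and
   B_(m+i') = [L_(i'), R_(m+i')] is the one of index j = m + i' - 1 >= m. *)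
Definition Amax (R : realType) (n M m : nat) (s : circle R)
    (pts : seq (circle R)) (j : 'I_n) : circular_arc R :=
  let w := Amax_labels n M m in
  let Lpt k := nth s (mask w pts) k in
  let Rpt k := nth s (mask (map negb w) pts) k in
  Arc (if (j < m)%N then Lpt (n - m + j)%N else Lpt (j - m)%N) (Rpt j).

Section EdgeCounts.
Variables n M m : nat.
Local Notation n' := (n%:R : rat).
Local Notation M' := (M%:R : rat).
Local Notation m' := (m%:R : rat).

Definition e_max_low : rat :=
  1 / 2 * (M' + 2 * M' * n' + 2 * M' * m' - M' ^+ 2 - m' ^+ 2 - m' - 2 * n').

Definition e_max_high : rat :=
  1 / 2 * (M' + 2 * M' * n' - 2 * M' * m' - M' ^+ 2 - m' ^+ 2 + 2 * m' * n'
           + m' - 2 * n').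

Definition e_max : rat :=
  if (2 * M <= n + 1)%N then e_max_low else e_max_high.

(* The two cases of e_max overlap consistently. *)
Lemma e_max_highE : (n + 1 <= 2 * M)%N -> e_max = e_max_high.
Proof.
rewrite /e_max => h1; case: (leqP (2 * M) (n + 1)) => // h2.
have h : (2 * M = n + 1)%N by apply: anti_leq; rewrite h2 h1.
have hn : n' = 2 * M' - 1.
  by apply/eqP; rewrite eq_sym subr_eq -natrM h natrD.
by rewrite /e_max_low /e_max_high hn; ring.
Qed.

Definition e_min : rat :=
  if (2 * M <= n + 3)%N then
    3 / 2 * M' + M' * n' + M' * m' - 1 / 2 * M' ^+ 2 - 3 / 2 * m'
    - 1 / 2 * m' ^+ 2 - 2 * n'
  else
    3 / 2 * M' + M' * n' - M' * m' - 1 / 2 * M' ^+ 2 + 3 / 2 * m'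
    + m' * n' - 1 / 2 * m' ^+ 2 - 2 * n'.

End EdgeCounts.

Definition guarantees_agreement (R : realType) (n M m : nat) (e : int) : Prop :=
  forall C : 'I_n -> circular_arc R,
    distinct_endpoints C -> min_agreement C = m -> e <= (num_edges C)%:Z ->
    (M <= max_agreement C)%N.

(* Main.v *)
Require Import Defs.
From mathcomp Require Import all_boot all_order all_algebra.
From mathcomp Require Import boolp reals zify ring lra.

Set Implicit Arguments.
Unset Strict Implicit.
Unset Printing Implicit Defensive.
Import Order.TTheory GRing.Theory Num.Theory.
Local Open Scope ring_scope.

(* In a collection C with distinct endpoints, let q be a point of minimum
   agreement m.  Two arcs meet iff one of them contains the left endpoint of the
   other, so C has at most \sum_j (a(L_j) - 1) edges.  The left endpoint of rank
   r clockwise from q satisfies a(L_j) <= min(M, m + r), because an arc through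
   it contains q or starts between q and it; summing gives the bound
   Mn - n - C(M - m, 2), the low value of e_max.  On the other hand, the n - m
   arcs avoiding q behave like intervals of a line: the one of rank r is
   disjoint from at least r - M earlier ones, hence there are at least
   C(n - m - M + 1, 2) disjoint pairs, which gives the high value.  The smaller
   of the two bounds is e_max.

   In A_max, with indices counted from 0, L_a precedes R_b iff a < M - m + b, so
   all intersections are explicit: for i < j the arcs of indices i and j are
   disjoint iff M + i <= j and (i < m -> j + M <= n + i).

   Finally e_min(M) = e_max(M - 1) + 1: the bounds only use max <= M - 1, and
   A_max for M - 1 shows that they are attained. *)

(** * Truncated sums, ranks and unordered pairs *)

Section Combinatorics.
Local Open Scope nat_scope.

Lemma sum_subn_ord n c : c <= n -> \sum_(r < n) (c - r.+1) = 'C(c, 2).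
Proof.
elim: n c => [[]//|n IH] c; first by rewrite big_ord0.
case: c => [|c] le_cn; first by rewrite big1.
by rewrite big_ord_recl subn1 binS bin1 addnC -(IH c).
Qed.

Lemma sum_subn_const n c : \sum_(r < n) (r.+1 - c) = 'C(n.+1 - c, 2).
Proof.
elim: n => [|n IH]; first by rewrite big_ord0; case: c => [|[]].
rewrite big_ord_recr /= IH; case: (leqP c n.+1) => le_cn.
  by rewrite [n.+2 - c]subSn // binS bin1.
by have [-> ->] : n.+1 - c = 0 /\ n.+2 - c = 0 by lia.
Qed.

Lemma sum_itv_ord n a b : \sum_(i < n) (a <= i < b) = minn b n - a.
Proof.
elim: n => [|n IH]; first by rewrite big_ord0; lia.
by rewrite big_ord_recr /= IH; lia.
Qed.

(** Injectivity makes the ranks run through 1, ..., [#|S|]. In the induction, the element of largest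
    key has rank [#|S|] and is counted in no other rank, so removing it leaves the others
    unchanged. *)
Lemma sum_rank d (K : orderType d) (T : finType) (key : T -> K) (f : nat -> nat)
    (S : {set T}) :
  {in S &, injective key} ->
  \sum_(i in S) f #|[set j in S | (key j <= key i)%O]|
    = \sum_(r < #|S|) f r.+1.
Proof.
move: {2}#|S| (erefl #|S|) => k; elim: k S => [|k IH] S cardS injS.
  by rewrite cardS big_ord0 (cards0_eq cardS) big_set0.
have [i0 i0S] : exists i0, i0 \in S by apply/card_gt0P; rewrite cardS.
have [i iS max_i] : exists2 i, i \in S & {in S, forall j, (key j <= key i)%O}.
  by have [i iS max_i] := Order.TotalTheory.arg_maxP key i0S; exists i.
have cardSi : #|S :\ i| = k by move: cardS; rewrite (cardsD1 i) iS => -[].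
rewrite (big_setD1 i) //= cardS big_ord_recr /= addnC; congr (_ + _); last first.
  congr f; rewrite -cardS; apply: eq_card => j; rewrite inE.
  by case jS: (j \in S) => //=; exact: max_i.
rewrite -cardSi -IH //; last first.
  by move=> x y /setD1P[_ xS] /setD1P[_ yS]; exact: injS.
apply: eq_bigr => j /setD1P[ji jS]; congr f; apply: eq_card => x.
rewrite !inE; case: eqP => [->|//] /=; rewrite iS /=.
apply/negP => le_ij; case/eqP: ji; apply: injS => //.
by apply/eqP; rewrite eq_le le_ij andbT; exact: max_i.
Qed.

Lemma card_pairs (T : finType) (p : rel T) :
  #|[set e : T * T | p e.1 e.2]| = \sum_i \sum_j p i j.
Proof.
rewrite -sum1_card (eq_bigl (fun e : T * T => p e.1 e.2)); last first.
  by move=> e; rewrite inE.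
by rewrite big_mkcond /= pair_bigA; apply: eq_bigr => e _; case: ifP.
Qed.

Variable n : nat.
Implicit Types p r : rel 'I_n.

Lemma sum_offdiag p :
  \sum_(i < n) \sum_(j < n) ((i != j) && p i j)
    = \sum_(i < n) \sum_(j < n) (((i < j) && p i j) + ((i < j) && p j i)).
Proof.
under [RHS]eq_bigr => i _ do rewrite big_split.
rewrite [RHS]big_split /= [X in _ = _ + X]exchange_big -big_split /=.
apply: eq_bigr => i _; rewrite -big_split /=; apply: eq_bigr => j _.
by rewrite -(inj_eq val_inj) /=; case: ltngtP => //=; rewrite addn0.
Qed.

(** Each unordered pair is charged to an order in which [p] holds. *)
Lemma leq_card_unordered p r :
  (forall i j, r i j -> p i j || p j i) ->
  #|[set e : 'I_n * 'I_n | (e.1 < e.2) && r e.1 e.2]|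
    <= \sum_(i < n) \sum_(j < n) ((i != j) && p i j).
Proof.
move=> rp; rewrite (card_pairs (fun i j : 'I_n => (i < j) && r i j)) sum_offdiag.
apply: leq_sum => i _; apply: leq_sum => j _; case: (i < j) => //=.
by case rij: (r i j) => //=; case/orP: (rp _ _ rij) => ->; rewrite ?addn1.
Qed.

(** The hypothesis makes [p] asymmetric off the diagonal, so no unordered pair is counted twice; [r]
    is asked in both orders because a pair is recorded only with [i < j]. *)
Lemma geq_card_unordered p r :
  (forall i j, i != j -> p i j -> r i j && r j i && ~~ p j i) ->
  \sum_(i < n) \sum_(j < n) ((i != j) && p i j)
    <= #|[set e : 'I_n * 'I_n | (e.1 < e.2) && r e.1 e.2]|.
Proof.
move=> pr; rewrite (card_pairs (fun i j : 'I_n => (i < j) && r i j)) sum_offdiag.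
apply: leq_sum => i _; apply: leq_sum => j _; case: ltnP => //= lt_ij.
have ij : i != j by rewrite -(inj_eq val_inj) neq_ltn lt_ij.
case pij: (p i j) => /=; first by have /andP[/andP[-> _] /negPf->] := pr _ _ ij pij.
case pji: (p j i) => //=; rewrite eq_sym in ij.
by have /andP[/andP[_ ->] _] := pr _ _ ij pji.
Qed.

Lemma card_ltn_pairs : #|[set e : 'I_n * 'I_n | e.1 < e.2]| = 'C(n, 2).
Proof.
rewrite (card_pairs (fun i j : 'I_n => i < j)) -bin2_sum big_mkord exchange_big /=.
apply: eq_bigr => i _; rewrite (sum_itv_ord n 0 i).
by rewrite subn0; apply/minn_idPl/ltnW.
Qed.
End Combinatorics.

(** * Clockwise distance and arcs *)

Section Circle.
Variable R : realType.
Implicit Types (a b p q s x y : circle R) (A B : circular_arc R).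

Lemma cw_itv x y : 0 <= cw x y < 1.
Proof.
rewrite /cw; have /andP[hx hx'] := valP x; have /andP[hy hy'] := valP y.
by apply/andP; case: (leP (val _) (val _)) => h; split; lra.
Qed.

Lemma cw_ge0 x y : 0 <= cw x y. Proof. by case/andP: (cw_itv x y). Qed.

Lemma cwxx x : cw x x = 0. Proof. by rewrite /cw lexx subrr. Qed.

(* The formula defining [cw] holds for distances measured from any base point s. *)
Lemma cw_rebase s x y :
  cw x y = if cw s x <= cw s y then cw s y - cw s x else 1 + cw s y - cw s x.
Proof.
rewrite /cw; have /andP[hx hx'] := valP x; have /andP[hy hy'] := valP y.
have /andP[hs hs'] := valP s.
by do 3![case: (leP (val _) (val _)) => ?]; case: leP => ?; lra.
Qed.

Lemma cw_inj s : injective (cw s).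
Proof.
move=> x y; rewrite /cw; have /andP[hx hx'] := valP x.
have /andP[hy hy'] := valP y; have /andP[hs hs'] := valP s.
by move=> h; apply: val_inj; move: h; do 2![case: (leP (val _) (val _)) => ?]; lra.
Qed.

(** Starting from [a], [p] comes before [q]; so a clockwise walk from [q] has to come back to [a]
    before it can reach [p]. *)
Lemma cw_rotate a p q : cw a p < cw a q -> cw q a <= cw q p.
Proof.
move=> lt_pq; rewrite !(cw_rebase a q) cwxx [cw a q <= cw a p]leNgt lt_pq /=.
have := cw_ge0 a p; have := cw_ge0 a q.
by case: (leP (cw a q) 0) => ? ? ?; lra.
Qed.

(** In the second case the arc runs through [s], so it is cut at [s] into a final and an initial
    segment. *)
Lemma on_arcE s A p :
  let l := cw s (left_end A) in let r := cw s (right_end A) in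
  on_arc A p = if l <= r then l <= cw s p <= r else (l <= cw s p) || (cw s p <= r).
Proof.
move=> l r; rewrite /on_arc !(cw_rebase s (left_end A)) -/l -/r.
have /andP[hl hl'] := cw_itv s (left_end A).
have /andP[hr hr'] := cw_itv s (right_end A).
have /andP[hp hp'] := cw_itv s p; rewrite -/l -/r in hl hl' hr hr'.
case: (leP l r) => lr; case: (leP l (cw s p)) => lp /=.
- by rewrite lerD2r.
- by apply/negP => ?; lra.
- by lra.
- by rewrite lerD2r lerD2l.
Qed.

Lemma left_on_arc A : on_arc A (left_end A).
Proof. by rewrite /on_arc cwxx cw_ge0. Qed.

Lemma arcs_meetP A B :
  arcs_meet A B <-> on_arc A (left_end B) || on_arc B (left_end A).
Proof.
split=> [[p [pA pB]]|/orP[hA|hB]]; last first.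
- by exists (left_end A); rewrite left_on_arc.
- by exists (left_end B); rewrite left_on_arc.
(* Going clockwise from the left endpoint of [A], either that of [B] comes no later than the common
   point [p], hence lies on [A], or it comes after [p] and [cw_rotate] exchanges the two arcs. *)
case: (leP (cw (left_end A) (left_end B)) (cw (left_end A) p)) => h.
  by rewrite /on_arc (le_trans h pA).
by rewrite orbC /on_arc (le_trans (cw_rotate h) pB).
Qed.

Lemma arcs_meetC A B : arcs_meet A B -> arcs_meet B A.
Proof. by case=> p [pA pB]; exists p. Qed.

(** An arc avoiding [q] is an interval once the circle is cut at [q], and its left endpoint is its
    first point. *)
Lemma cw_left_end q A p : ~~ on_arc A q -> on_arc A p -> cw q (left_end A) <= cw q p.
Proof. by rewrite -ltNge => hq hp; apply/cw_rotate/(le_lt_trans hp hq). Qed.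

(** If the arcs met, [B] would contain the left endpoint of [A]; as [B] avoids [q] it would then
    start no later than [A], which forces equal left endpoints. *)
Lemma disjoint_from_later q A B :
  ~~ on_arc B q -> cw q (left_end A) <= cw q (left_end B) ->
  ~~ on_arc A (left_end B) -> ~ arcs_meet A B.
Proof.
move=> qB leAB nAB /arcs_meetP; rewrite (negPf nAB) /= => hBA.
have eqL : left_end A = left_end B.
  by apply: (@cw_inj q); apply/eqP; rewrite eq_le leAB cw_left_end.
by rewrite -eqL left_on_arc in nAB.
Qed.

End Circle.

(** * The two upper bounds on the number of edges *)

Section UpperBounds.
Local Open Scope nat_scope.
Variables (R : realType) (n : nat) (C : 'I_n -> circular_arc R).
Local Notation L i := (left_end (C i)).

Lemma agreementE p : agreement C p = \sum_i on_arc (C i) p.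
Proof.
rewrite /agreement -sum1_card big_mkcond; apply: eq_bigr => i _.
by rewrite inE; case: on_arc.
Qed.

Lemma agreement_le_max p : agreement C p <= max_agreement C.
Proof.
by rewrite /max_agreement; case: ex_maxnP => k _; apply; apply/asboolP; exists p.
Qed.

Lemma max_agreement_le k : (forall p, agreement C p <= k) -> max_agreement C <= k.
Proof. by move=> le_k; rewrite /max_agreement; case: ex_maxnP => _ /asboolP[p <-]. Qed.

Lemma min_agreement_le p : min_agreement C <= agreement C p.
Proof.
by rewrite /min_agreement; case: ex_minnP => k _; apply; apply/asboolP; exists p.
Qed.

Lemma min_agreement_attained : exists q, agreement C q = min_agreement C.
Proof. by rewrite /min_agreement; case: ex_minnP => k /asboolP. Qed.

Lemma num_edges_compl :
  num_edges C + #|[set e : 'I_n * 'I_n |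
      (e.1 < e.2) && ~~ `[< arcs_meet (C e.1) (C e.2) >]]| = 'C(n, 2).
Proof.
rewrite -(card_ltn_pairs n) -[RHS](cardsID [set e | `[< arcs_meet (C e.1) (C e.2) >]]).
by congr (_ + _); apply: eq_card => e; rewrite !inE // andbC.
Qed.

Variables (M : nat) (q : circle R).
Hypothesis distC : distinct_endpoints C.
Hypothesis leM : forall p, agreement C p <= M.
Local Notation m := (agreement C q).

Lemma left_key_inj : injective (fun i => cw q (L i)).
Proof.
by move=> i j /cw_inj eqL; have [] := @distC (i, true) (j, true) eqL.
Qed.

Lemma agreement_left_rank i :
  agreement C (L i) <= m + #|[set j | (cw q (L j) <= cw q (L i))%R]|.
Proof.
rewrite /agreement; apply: leq_trans (leq_card_setU _ _); apply/subset_leq_card.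
apply/subsetP => j; rewrite !inE => hj; case hq: (on_arc _ q) => //=.
by apply: (@cw_left_end _ q (C j)); rewrite ?hq.
Qed.

Lemma num_edges_le_low : M - m <= n -> num_edges C + n + 'C(M - m, 2) <= M * n.
Proof.
move=> le_n.
(* The summand [n] accounts for each arc containing its own left endpoint. *)
have le_sum : num_edges C + n <= \sum_i agreement C (L i).
  pose p i j := on_arc (C j) (L i).
  have hE : num_edges C <= \sum_i \sum_j ((i != j) && p i j).
    apply: (@leq_card_unordered _ p (fun i j => `[< arcs_meet (C i) (C j) >])).
    by move=> i j /asboolP /arcs_meetP; rewrite orbC.
  rewrite -[X in _ + X]card_ord -sum1_card.
  apply: (leq_trans (leq_add hE (leqnn _))); rewrite -big_split /=.
  apply: leq_sum => i _; rewrite agreementE (bigD1 i) //= eqxx add0n addnC.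
  rewrite [X in _ <= X](bigD1 i) //= left_on_arc leq_add2l.
  by apply: leq_sum => j _; rewrite /p; case: (i != j).
have le_min i : agreement C (L i) <=
    minn M (m + #|[set j in setT | (cw q (L j) <= cw q (L i))%R]|).
  rewrite leq_min leM (leq_trans (agreement_left_rank i)) // leq_add2l.
  by apply/subset_leq_card/subsetP => j; rewrite !inE.
have := sum_rank (fun r => minn M (m + r)) (in2W left_key_inj : {in [set: 'I_n] &, _}).
rewrite cardsT card_ord (eq_bigl xpredT) => [eq_rank|i]; last by rewrite inE.
apply: (@leq_trans (\sum_(r < n) minn M (m + r.+1) + 'C(M - m, 2))).
  by rewrite leq_add2r -eq_rank (leq_trans le_sum) //; apply: leq_sum.
rewrite -(sum_subn_ord le_n) -big_split /= mulnC -[X in X * _]card_ord -sum_nat_const.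
(* Termwise, [M - m - r.+1] is exactly what [minn M (m + r.+1)] lacks to reach [M]. *)
by apply: leq_sum => r _; have := leM q; lia.
Qed.

Lemma num_edges_le_high : num_edges C + 'C(n.+1 - m - M, 2) <= 'C(n, 2).
Proof.
rewrite -num_edges_compl leq_add2l.
pose S := [set i | ~~ on_arc (C i) q].
have cardS : #|S| = n - m.
  rewrite cardsCs card_ord; congr (n - _).
  by apply: eq_card => i; rewrite !inE negbK.
(* Cut at [q], the arc [j] starts no later than [i] and misses its left endpoint, so the two are
   disjoint. *)
pose p i j := [&& i \in S, j \in S, (cw q (L j) <= cw q (L i))%R
                & ~~ on_arc (C j) (L i)].
have asym_p i j : i != j -> p i j ->
    ~~ `[< arcs_meet (C i) (C j) >] && ~~ `[< arcs_meet (C j) (C i) >] && ~~ p j i.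
  move=> ij /and4P[iS jS le_ji nji]; rewrite inE in iS.
  have nmeet : ~ arcs_meet (C j) (C i) by exact: disjoint_from_later le_ji nji.
  apply/andP; split; first by apply/andP; split; apply/asboolPn => // /arcs_meetC.
  apply/and4P => -[_ _ le_ij _]; case/eqP: ij; apply: left_key_inj.
  by apply/eqP; rewrite eq_le le_ij.
pose disj i j := ~~ `[< arcs_meet (C i) (C j) >].
apply: leq_trans (@geq_card_unordered _ p disj asym_p).
rewrite subSn; last by rewrite -[leqRHS]card_ord max_card.
rewrite -sum_subn_const -cardS.
rewrite -(sum_rank (fun r => r - M) (in2W left_key_inj : {in S &, _})).
rewrite big_mkcond; apply: leq_sum => i _; case: ifP => // iS.
(* Of the arcs of [S] starting no later than [i], at most [M] contain the left endpoint of [i],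
   itself included; all others are related to [i] by [p]. *)
rewrite leq_subLR; apply: (leq_trans _ (leq_add (leM (L i)) (leqnn _))).
rewrite agreementE -big_split /= -sum1_card big_mkcond.
apply: leq_sum => j _; rewrite /p iS !inE.
case nji: (on_arc (C j) (L i)); first by case: ifP.
have -> : i != j by apply: contraFneq nji => ->; exact: left_on_arc.
by rewrite andbT; case: (_ && _).
Qed.

End UpperBounds.

(** * Positions of the labels L and R *)

Section Positions.
Local Open Scope nat_scope.

(* With d = M - m and k = n - M + m, the 0-based positions of L_(a+1) and R_(b+1)
   in the label sequence. *)
Definition Lpos d a := if a < d then a else a.*2.+1 - d.
Definition Rpos d k b := if b < k then d + b.*2 else d + k + b.

Section Order.
Variables (d k : nat).

Lemma leq_LposL a a' : (Lpos d a <= Lpos d a') = (a <= a').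
Proof. by rewrite /Lpos; do 2!case: ifP; lia. Qed.

Lemma leq_RposR b b' :
  b < d + k -> b' < d + k -> (Rpos d k b <= Rpos d k b') = (b <= b').
Proof. by rewrite /Rpos; do 2!case: ifP; lia. Qed.

Lemma leq_LposR a b : a < d + k -> b < d + k -> (Lpos d a <= Rpos d k b) = (a < d + b).
Proof. by rewrite /Lpos /Rpos; do 2!case: ifP; lia. Qed.

Lemma leq_RposL a b : a < d + k -> b < d + k -> (Rpos d k b <= Lpos d a) = (d + b <= a).
Proof. by rewrite /Lpos /Rpos; do 2!case: ifP; lia. Qed.

Lemma Lpos_lt a : a < d + k -> Lpos d a < 2 * (d + k).
Proof. by rewrite /Lpos; case: ifP; lia. Qed.

Lemma Rpos_lt b : b < d + k -> Rpos d k b < 2 * (d + k).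
Proof. by rewrite /Rpos; case: ifP; lia. Qed.

End Order.

(** With [b] false this selects the L of each pair R, L (offset 1); with [b] true, after negating
    the labels, the R (offset 0). *)
Lemma mask_alternate (T : Type) (x0 : T) (b : bool) k (s : seq T) :
  size s = 2 * k ->
  mask (flatten (nseq k [:: b; ~~ b])) s
    = mkseq (fun a => nth x0 s (a.*2 + ~~ b)) k.
Proof.
elim: k s => [|k IH] [|x [|y s]] //= => [[sz]|sz]; [by lia|].
rewrite {}IH; last by lia.
rewrite /mkseq /= (iotaDl 1 0) -map_comp.
by case: b.
Qed.

Variables (T : Type) (x0 : T) (n M m : nat) (pts : seq T).
Hypotheses (le_mM : m <= M) (le_Mn : M <= n) (sz : size pts = 2 * n).
Local Notation d := (M - m).
Local Notation k := (n - M + m).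

Lemma nth_Lpos a : a < n ->
  nth x0 (mask (Amax_labels n M m) pts) a = nth x0 pts (Lpos d a).
Proof.
(* The points are cut into blocks of sizes [d], [2 * k] and [d], matching the three blocks of
   labels. *)
move=> lt_an; rewrite -{1}(cat_take_drop d pts) -(cat_take_drop (2 * k) (drop d pts)).
rewrite /Amax_labels !mask_cat ?size_nseq ?size_takel ?size_drop ?sz; try by lia.
- rewrite mask_true ?size_takel ?sz; try by lia.
  rewrite mask_false cats0 (mask_alternate x0) ?size_takel ?size_drop ?sz; try by lia.
  rewrite nth_cat size_takel ?sz; last by lia.
  rewrite /Lpos; case: ltnP => [lt_ad|le_da]; first by rewrite nth_take.
  rewrite nth_mkseq; last by lia.
  rewrite nth_take ?nth_drop; last by lia.
  by congr nth; lia.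
- by rewrite size_flatten /shape map_nseq sumn_nseq /=; lia.
Qed.

Lemma nth_Rpos b : b < n ->
  nth x0 (mask (map negb (Amax_labels n M m)) pts) b = nth x0 pts (Rpos d k b).
Proof.
move=> lt_bn; rewrite -{1}(cat_take_drop d pts) -(cat_take_drop (2 * k) (drop d pts)).
rewrite /Amax_labels !map_cat map_flatten !map_nseq /=.
rewrite !mask_cat ?size_nseq ?size_takel ?size_drop ?sz; try by lia.
- rewrite mask_true ?size_drop ?sz; try by lia.
  rewrite mask_false cat0s (mask_alternate x0 true) //;
    rewrite ?size_takel ?size_drop ?sz; try by lia.
  rewrite nth_cat size_mkseq.
  rewrite /Rpos; case: ltnP => [lt_bk|le_kb].
    by rewrite nth_mkseq // nth_take ?nth_drop ?addn0 //; lia.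
  by rewrite !nth_drop; congr nth; lia.
- by rewrite size_flatten /shape map_nseq sumn_nseq /=; lia.
Qed.

End Positions.

Lemma cw_nth_lt (R : realType) (s : circle R) pts :
  clockwise_from s pts ->
  {in gtn (size pts) &, {mono nth s pts : i j / (i < j)%N >-> cw s i < cw s j}}.
Proof.
move=> cws; have tr : transitive (fun x y : circle R => cw s x < cw s y).
  by move=> y x z; exact: lt_trans.
have homo := sorted_ltn_nth tr s cws.
move=> i j hi hj; case: (ltngtP i j) => [ij|ji|->].
- exact: homo.
- by apply/negbTE; rewrite -leNgt ltW //; exact: homo.
- exact: ltxx.
Qed.

(** * Intersections in A_max *)

Section AmaxArcs.
Local Open Scope nat_scope.
Variables (n M m : nat).
Hypotheses (lt_mM : m < M) (le_Mn : M <= n).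

Local Notation d := (M - m).
Local Notation k := (n - M + m).

(** This is [j - m] modulo [n], a cyclic shift of the indices. *)
Definition Amax_left (j : nat) := if j < m then n - m + j else j - m.

Lemma Amax_left_lt j : j < n -> Amax_left j < n.
Proof. by rewrite /Amax_left; case: ifP; lia. Qed.

Let nE : n = d + k. Proof. by lia. Qed.

Lemma Lpos_bound a : a < n -> Lpos d a < 2 * n.
Proof. by move=> ?; rewrite [X in 2 * X]nE; apply: Lpos_lt; rewrite -nE. Qed.

Lemma Rpos_bound b : b < n -> Rpos d k b < 2 * n.
Proof. by move=> ?; rewrite [X in 2 * X]nE; apply: Rpos_lt; rewrite -nE. Qed.

Variables (R : realType) (s : circle R) (pts : seq (circle R)).
Hypotheses (sz : size pts = 2 * n) (cws : clockwise_from s pts).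
Local Notation C := (@Amax R n M m s pts).
Local Notation cwL a := (cw s (nth s pts (Lpos d a))).
Local Notation cwR b := (cw s (nth s pts (Rpos d k b))).

Lemma AmaxE (j : 'I_n) :
  C j = Arc (nth s pts (Lpos d (Amax_left j))) (nth s pts (Rpos d k j)).
Proof.
have lt_jn := ltn_ord j; have := Amax_left_lt lt_jn.
rewrite /Amax /Amax_left => lt_n; rewrite nth_Rpos ?(ltnW lt_mM) //; congr Arc.
by move: lt_n; case: ifP => _ lt_n; rewrite nth_Lpos // ltnW.
Qed.

Lemma cw_nth_le i j : i < 2 * n -> j < 2 * n ->
  (cw s (nth s pts i) <= cw s (nth s pts j))%R = (i <= j).
Proof.
by move=> hi hj; rewrite leNgt cw_nth_lt // ?inE ?sz // -leqNgt.
Qed.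

Lemma cwL_leL a a' : a < n -> a' < n -> (cwL a <= cwL a')%R = (a <= a').
Proof. by move=> ? ?; rewrite cw_nth_le ?Lpos_bound // leq_LposL. Qed.

Lemma cwL_leR a b : a < n -> b < n -> (cwL a <= cwR b)%R = (a < d + b).
Proof.
by move=> ? ?; rewrite cw_nth_le ?Lpos_bound ?Rpos_bound // leq_LposR // -nE.
Qed.

Lemma Amax_unwrapped (j : 'I_n) : (cwL (Amax_left j) <= cwR j)%R = (m <= j).
Proof.
have := ltn_ord j; rewrite cwL_leR ?Amax_left_lt // /Amax_left.
by case: ifP; lia.
Qed.

Lemma on_arc_Amax (j : 'I_n) a : a < n ->
  on_arc (C j) (nth s pts (Lpos d a))
    = if m <= j then Amax_left j <= a < d + j else (Amax_left j <= a) || (a < d + j).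
Proof.
move=> lt_an; rewrite (on_arcE s) AmaxE /= Amax_unwrapped.
by rewrite cwL_leL ?cwL_leR // Amax_left_lt.
Qed.

(** Disjointness is put as an interval condition on [j], so that [sum_itv_ord] counts the later arcs
    disjoint from [i]. *)
Lemma arcs_meet_Amax (i j : 'I_n) : i < j ->
  `[< arcs_meet (C i) (C j) >] = ~~ (M + i <= j < if i < m then n + i + 1 - M else n).
Proof.
move=> lt_ij; rewrite (asbool_equiv_eq (arcs_meetP _ _)) asboolb.
have lt_jn := ltn_ord j; have lt_in := ltn_ord i.
have -> : left_end (C i) = nth s pts (Lpos d (Amax_left i)) by rewrite AmaxE.
have -> : left_end (C j) = nth s pts (Lpos d (Amax_left j)) by rewrite AmaxE.
rewrite !on_arc_Amax ?Amax_left_lt // /Amax_left.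
by case: (ltnP i m) => im; case: (ltnP j m) => jm; lia.
Qed.

(** Disjoint pairs are counted by their smaller index: each index below [m] gives [n + 1 - 2 * M] of
    them, and the other indices together give the binomial. Truncated subtraction lets one formula
    serve both cases of [e_max]. *)
Lemma num_edges_Amax : M + m <= n + 1 ->
  num_edges C + m * (n + 1 - 2 * M) + 'C(n.+1 - m - M, 2) = 'C(n, 2).
Proof.
move=> le_Mm; rewrite -(num_edges_compl C) -addnA; congr (_ + _).
rewrite (card_pairs (fun i j : 'I_n => (i < j) && ~~ `[< arcs_meet (C i) (C j) >])).
pose F i := if i < m then n + 1 - 2 * M else n - (M + i).
have -> : \sum_(i < n) \sum_(j < n) ((i < j) && ~~ `[< arcs_meet (C i) (C j) >])
    = \sum_(0 <= i < n) F i.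
  rewrite big_mkord; apply: eq_bigr => i _.
  have lt_in := ltn_ord i.
  rewrite -(@eq_bigr _ _ _ _ _ _ (fun j : 'I_n =>
    (M + i <= j < if i < m then n + i + 1 - M else n) : nat)).
    by rewrite sum_itv_ord /F; case: ifP; lia.
  move=> j _; case: (ltnP i j) => [lt_ij|le_ji] /=.
    by rewrite arcs_meet_Amax // negbK.
  by case: ifP; lia.
rewrite (big_cat_nat _ (n := m)) //=; last by lia.
congr (_ + _).
  rewrite (eq_big_nat _ _ (F2 := fun=> n + 1 - 2 * M)).
    by rewrite sum_nat_const_nat subn0.
  by move=> i /andP[_ lt_im]; rewrite /F lt_im.
have -> : \sum_(m <= i < n) F i = \sum_(0 + m <= i < n) F i by [].
rewrite big_addn big_mkord -(sum_subn_ord (n := n - m)); last by lia.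
by apply: eq_bigr => i _; rewrite /F; case: ifP; lia.
Qed.

(* Counting from s, an arc contributes [L <= p] - [R < p], plus 1 if it is one of
   the m arcs running through s. *)
Lemma agreement_Amax p :
  agreement C p + \sum_(b < n) (cwR b < cw s p)%R
    = \sum_(a < n) (cwL a <= cw s p)%R + m.
Proof.
pose h (j : 'I_n) := Ordinal (Amax_left_lt (ltn_ord j)).
have h_inj : injective h.
  move=> i j /(congr1 val) /= eqij; apply: val_inj => /=.
  have := ltn_ord i; have := ltn_ord j; move: eqij; rewrite /Amax_left.
  by do 2!case: ifP; lia.
rewrite [in RHS](reindex_inj h_inj) /= agreementE.
rewrite [X in _ = _ + X](_ : m = \sum_(j < n) (0 <= j < m)); last first.
  by rewrite sum_itv_ord; lia.
rewrite -!big_split /=; apply: eq_bigr => j _.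
rewrite (on_arcE s) AmaxE /= Amax_unwrapped.
have := Amax_unwrapped j; case: (ltnP j m) => _ lr.
  have {}lr : (cwR j < cwL (Amax_left j))%R by rewrite ltNge lr.
  by case: (ltP (cwR j)) => h1; rewrite ?orbF ?orbT ?addn0 //= leNgt (le_lt_trans h1).
case: (ltP (cwR j)) => h1; last by rewrite andbT.
by rewrite andbF (le_trans lr (ltW h1)).
Qed.

End AmaxArcs.

(** * Agreement numbers and endpoints of A_max *)

Section AmaxAgreement.
Local Open Scope nat_scope.
Variables (R : realType) (n M m : nat) (s : circle R) (pts : seq (circle R)).
Hypotheses (lt_mM : m < M) (le_Mn : M <= n).
Hypotheses (sz : size pts = 2 * n) (cws : clockwise_from s pts).
Local Notation d := (M - m).
Local Notation k := (n - M + m).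
Local Notation C := (@Amax R n M m s pts).
Local Notation cwL a := (cw s (nth s pts (Lpos d a))).
Local Notation cwR b := (cw s (nth s pts (Rpos d k b))).

(** By [agreement_Amax], it suffices that each R before [p] be matched with an L up to [p]: the L of
    the same index precedes it because [0 < d]. *)
Lemma Amax_agreement_ge p : m <= agreement C p.
Proof.
have := agreement_Amax lt_mM le_Mn sz cws p.
suff : \sum_(b < n) (cwR b < cw s p)%R <= \sum_(a < n) (cwL a <= cw s p)%R by lia.
apply: leq_sum => a _; case: (ltP (cwR a)) => //= lt_p.
rewrite (le_trans _ (ltW lt_p)) // cwL_leR //.
by lia.
Qed.

(** Apart from the first [d] of them, an L up to [p] is matched with the R whose index is smaller by
    [d], which precedes it. *)
Lemma Amax_agreement_le p : agreement C p <= M.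
Proof.
have := agreement_Amax lt_mM le_Mn sz cws p.
suff : \sum_(a < n) (cwL a <= cw s p)%R <= d + \sum_(b < n) (cwR b < cw s p)%R.
  by lia.
rewrite -(big_mkord xpredT (fun a => (cwL a <= cw s p)%R : nat)).
rewrite -(big_mkord xpredT (fun b => (cwR b < cw s p)%R : nat)).
rewrite (big_cat_nat _ (n := d)) //=; last by lia.
apply: leq_add.
  rewrite -[X in _ <= X]subn0 -[X in _ <= X]muln1 -sum_nat_const_nat.
  by apply: leq_sum => a _; exact: leq_b1.
rewrite -{1}[d]add0n big_addn.
rewrite [X in _ <= X](big_cat_nat _ (n := n - d)) //=; last by lia.
apply: leq_trans (leq_addr _ _); rewrite !big_mkord.
apply: leq_sum => b _; case: (leP (cwL (b + d))) => //= le_p.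
have lt_bn := ltn_ord b.
rewrite (lt_le_trans _ le_p) // ltNge cwL_leR //; lia.
Qed.

Lemma Amax_min_agreement :
  all (fun x => 0 < cw s x)%R pts -> min_agreement C = m.
Proof.
move=> /allP pos; apply/eqP; rewrite eqn_leq; apply/andP; split; last first.
  by have [q <-] := min_agreement_attained C; exact: Amax_agreement_ge.
(* The minimum is attained at [s]: all points lie strictly after it, so only the [m] arcs running
   through [s] contain it. *)
apply: leq_trans (min_agreement_le C s) _.
have := agreement_Amax lt_mM le_Mn sz cws s.
rewrite [X in _ = X + _]big1 => [|a _]; first by lia.
rewrite cwxx leNgt pos //; apply: mem_nth; rewrite sz.
exact: Lpos_bound lt_mM le_Mn _ _.
Qed.

(** Positions determine points, so it suffices that [pos] be injective; an L and an R in the same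
    position would need both [a < d + b] and [d + b <= a]. *)
Lemma Amax_distinct_endpoints : distinct_endpoints C.
Proof.
pose pos (e : 'I_n * bool) := if e.2 then Lpos d (Amax_left n m e.1) else Rpos d k e.1.
have endE e : endpoint C e = nth s pts (pos e).
  by case: e => j []; rewrite /endpoint AmaxE.
have nE : n = d + k by lia.
have pos_lt e : pos e < 2 * n.
  rewrite /pos; case: ifP => _; last first.
    exact: (Rpos_bound lt_mM le_Mn (ltn_ord _)).
  exact: (Lpos_bound lt_mM le_Mn (Amax_left_lt lt_mM le_Mn (ltn_ord _))).
have lt_left (j : 'I_n) : Amax_left n m j < d + k.
  by rewrite -nE; exact: (Amax_left_lt lt_mM le_Mn (ltn_ord j)).
have lt_ord (j : 'I_n) : j < d + k by rewrite -nE.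
move=> e f; rewrite !endE => eq_nth.
have: pos e == pos f.
  have le_pos := cw_nth_le sz cws.
  rewrite eqn_leq -(le_pos _ _ (pos_lt e) (pos_lt f)).
  by rewrite -(le_pos _ _ (pos_lt f) (pos_lt e)) eq_nth lexx.
rewrite eqn_leq; case: e f {eq_nth} => [i b] [j c]; rewrite /pos.
case: b; case: c => /=;
  rewrite ?leq_LposL ?leq_RposR ?leq_LposR ?leq_RposL //; try by lia.
- rewrite -eqn_leq => /eqP eq_left; congr pair; apply: val_inj => /=.
  have := ltn_ord i; have := ltn_ord j; move: eq_left; rewrite /Amax_left.
  by do 2!case: ifP; lia.
- by rewrite -eqn_leq => /eqP eq_ij; congr pair; exact: val_inj.
Qed.

End AmaxAgreement.

Lemma clockwise_points (R : realType) N :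
  exists s : circle R, exists pts : seq (circle R),
    [/\ size pts = N, clockwise_from s pts & all (fun x => 0 < cw s x) pts].
Proof.
have h0 : 0 <= (0 : R) < 1 by rewrite lexx ltr01.
pose s : circle R := exist _ 0 h0.
(* The numerator [i.+1] keeps the points off [s], and the denominator [N.+1] keeps them below 1; the
   default [s] is only taken for [i >= N]. *)
pose x i : circle R := insubd s (i.+1%:R / N.+1%:R).
have cw_x i : (i < N)%N -> cw s (x i) = i.+1%:R / N.+1%:R.
  move=> lt_iN; have x_itv : 0 <= (i.+1%:R / N.+1%:R : R) < 1.
    by rewrite divr_ge0 //= ltr_pdivrMr // mul1r ltr_nat.
  by rewrite /cw /x val_insubd x_itv subr0 (andP x_itv).1.
exists s; exists (mkseq x N); split; first exact: size_mkseq.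
  rewrite /clockwise_from sorted_map.
  apply: (sub_in_sorted (P := gtn N)) (iota_ltn_sorted 0 N).
    by move=> i j hi hj /= lt_ij; rewrite !cw_x // ltr_pM2r ?invr_gt0 // ltr_nat.
  by apply/allP => i; rewrite mem_iota.
apply/allP => _ /mapP[i + ->]; rewrite mem_iota => lt_iN.
by rewrite cw_x // divr_gt0.
Qed.

(** * Closed forms of the bounds *)

Lemma natr_bin2 (k : nat) : ('C(k, 2))%:R = k%:R * (k%:R - 1) / 2 :> rat.
Proof.
elim: k => [|k IH]; first by rewrite !mul0r.
by rewrite binS bin1 natrD IH -natr1; field.
Qed.

Section EdgeBound.
Variables n M m : nat.
Hypothesis le_Mm : (M + m <= n + 1)%N.

Lemma e_max_high_bin2 :
  e_max_high n M m = ('C(n, 2))%:R - ('C(n.+1 - m - M, 2))%:R.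
Proof.
rewrite /e_max_high !natr_bin2 -subnDA natrB; last by lia.
by rewrite natrD -natr1; field.
Qed.

Hypothesis le_mM : (m <= M)%N.

Lemma e_max_low_bin2 : e_max_low n M m = M%:R * n%:R - n%:R - ('C(M - m, 2))%:R.
Proof. by rewrite /e_max_low natr_bin2 natrB //; field. Qed.

(** [e_max] is a rational expression, while the threshold in [guarantees_agreement] is an
    integer. *)
Lemma e_max_integral : exists z : int, z%:~R = e_max n M m.
Proof.
rewrite /e_max e_max_low_bin2 e_max_high_bin2; case: ifP => _.
  exists ((M * n)%:Z - n%:Z - 'C(M - m, 2)%:Z).
  by rewrite !rmorphB /= -!pmulrn natrM.
exists ('C(n, 2)%:Z - 'C(n.+1 - m - M, 2)%:Z).
by rewrite rmorphB /= -!pmulrn.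
Qed.

Lemma e_minE : e_min n M.+1 m = e_max n M m + 1.
Proof.
rewrite /e_min /e_max; have -> : (2 * M.+1 <= n + 3)%N = (2 * M <= n + 1)%N by lia.
by rewrite /e_max_low /e_max_high -natr1; case: ifP => _; field.
Qed.

Lemma num_edges_le_e_max (R : realType) (C : 'I_n -> circular_arc R) :
  (M <= n)%N -> distinct_endpoints C -> min_agreement C = m ->
  (max_agreement C <= M)%N -> (num_edges C)%:R <= e_max n M m.
Proof.
move=> le_Mn distC min_m max_M; have [q q_min] := min_agreement_attained C.
have le_M p : (agreement C p <= M)%N := leq_trans (agreement_le_max C p) max_M.
have := num_edges_le_high q distC le_M.
have := @num_edges_le_low _ _ C M q distC le_M; rewrite q_min min_m.
move=> /(_ (leq_trans (leq_subr _ _) le_Mn)).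
rewrite -!(ler_nat rat) !natrD natrM /e_max e_max_low_bin2 e_max_high_bin2.
by case: ifP => _; lra.
Qed.

End EdgeBound.

(** The two closed forms differ by [m * (n + 1 - 2 * M)], the middle term of [num_edges_Amax], which
    truncates to 0 in the high case. *)
Lemma natr_num_edges_Amax (R : realType) (n M m : nat) (s : circle R)
    (pts : seq (circle R)) :
  (m < M)%N -> (M <= n)%N -> (M + m <= n + 1)%N ->
  size pts = (2 * n)%N -> clockwise_from s pts ->
  (num_edges (@Amax R n M m s pts))%:R = e_max n M m.
Proof.
move=> lt_mM le_Mn le_Mm sz cws.
have := num_edges_Amax lt_mM le_Mn sz cws le_Mm.
move/(congr1 (fun k => k%:R : rat)); rewrite !natrD natrM => eq_n.
have high := e_max_high_bin2 le_Mm; rewrite /e_max; case: ifP => cond.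
  rewrite natrB // natrD natrM in eq_n.
  have -> : e_max_low n M m
      = e_max_high n M m - m%:R * (n%:R + 1 - 2 * M%:R).
    by rewrite /e_max_low /e_max_high; field.
  by rewrite high; lra.
have eq0 : (n + 1 - 2 * M = 0)%N by lia.
by rewrite eq0 mulr0 in eq_n; rewrite high; lra.
Qed.

Theorem theorem17 (R : realType) (n M m : nat)
    (hmM : (m < M)%N) (hMn : (M <= n)%N) (hMm : (M + m <= n + 1)%N) :
  [/\ forall (s : circle R) (pts : seq (circle R)),
        size pts = (2 * n)%N -> clockwise_from s pts ->
        (num_edges (@Amax R n M m s pts))%:R = e_max n M m,
      forall C : 'I_n -> circular_arc R,
        satisfies_conditions C M m -> (num_edges C)%:R <= e_max n M m
    & exists2 e : int, e%:~R = e_min n M m &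
        guarantees_agreement R n M m e /\
        ((m + 1 < M)%N ->
         forall e' : int, guarantees_agreement R n M m e' -> e <= e')].
Proof.
split.
- by move=> s pts; exact: natr_num_edges_Amax.
- move=> C [distC max_M min_m].
  by apply: num_edges_le_e_max; rewrite ?max_M // ltnW.
case: M hmM hMn hMm => // M' le_mM lt_Mn le_Mm; rewrite ltnS in le_mM.
have {}le_Mm : (M' + m <= n + 1)%N by lia.
have [z zE] := e_max_integral le_Mm le_mM.
exists (z + 1); first by rewrite rmorphD /= zE e_minE.
split=> [C distC min_m|lt_mM e' guar].
  (* Contrapositive: maximum agreement at most [M'] allows at most [z] edges. *)
  apply: contraTT; rewrite -leqNgt -ltNge ltzD1 => max_M.
  rewrite -(ler_int rat) zE -pmulrn.
  exact: num_edges_le_e_max (ltnW lt_Mn) distC min_m max_M.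
rewrite lezD1 ltNge; apply/negP => le_e'z.
(* This makes A_max available for [M']: it has [z] edges and maximum agreement at most [M'], which
   refutes any threshold up to [z]. *)
have {}lt_mM : (m < M')%N by lia.
have [s [pts [sz cws pos]]] := clockwise_points R (2 * n).
have le_Mn := ltnW lt_Mn; pose C := @Amax R n M' m s pts.
have : (M' < max_agreement C)%N.
  apply: guar; [exact: Amax_distinct_endpoints | exact: Amax_min_agreement | ].
  apply: le_trans le_e'z _; rewrite -(ler_int rat) zE -pmulrn.
  by rewrite natr_num_edges_Amax.
by rewrite ltnNge max_agreement_le // => p; exact: Amax_agreement_le.
Qed.
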